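(* Suppose that $K$ is locally compact. Let $\ell=a_1|f_1|+\dots+a_N|f_N|$ be a positive linear combination ($a_i>0$) of non-constant absolute polynomials in one variable on $\mathcal B^1$, where $f_i(x)=\sum_{j=0}^{n_i}b_{ij}x^j\in K[x]$ with $b_{in_i}\ne0$, $n_i\ge 1$. Then $\ell$ has a global minimum on $\mathcal B^1$, and all global minima lie below (i.e. are contained in) the disc $B_{\mathcal B}(0,R)$, where $$R=\max_i\frac{|f_i(B_{\mathrm{Gauss}})|}{|b_{in_i}|},\qquad B_{\mathrm{Gauss}}=B_{\mathcal B}(0,1).$$ Moreover, if all the $f_i$ split over $K$, then any global minimum is attained at a root of one of the $f_i$.
   Context: $K$ is a field with a non-trivial valuation $\mathrm{val}\colon K\to\mathbb R\cup\{\infty\}$, complete with respect to the associated non-Archimedean absolute value $|a|=\exp(-\mathrm{val}(a))$. $\hat K$ is the completion of an algebraic closure of $K$, with the unique extension of $|\cdot|$. For $a\in K$, $r\in\mathbb R_{\ge0}$ put $B_{\mathcal B}(a,r)=\{z\in\hat K: |a-z|\le r\}$; $\mathcal B^1$ is the set of all of these discs, ordered by inclusion, and $K\subseteq\mathcal B^1$ via $a\mapsto B_{\mathcal B}(a,0)$. For $f\in K[x]$ and $B\in\mathcal B^1$, $|f|(B)=|f(B)|=\sup_{z\in B}|f(z)|$. A global minimum of $\ell$ on $\mathcal B^1$ is a $B\in\mathcal B^1$ with $\ell(B)=\inf_{B'\in\mathcal B^1}\ell(B')$. *)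

(* Defs.v *)
From HB Require Import structures.
From mathcomp Require Import all_boot all_order all_algebra.
From mathcomp Require Import all_classical all_reals all_analysis.

Set Implicit Arguments.
Unset Strict Implicit.
Unset Printing Implicit Defensive.

Import Order.TTheory GRing.Theory Num.Theory.

Local Open Scope classical_set_scope.
Local Open Scope ring_scope.

(* A valuation K -> R u {oo}; \bar R also contains -oo, which is excluded. *)
Record valuation (R : realType) (K : fieldType) := Valuation {
  valuation_fun :> K -> \bar R;
  valuation_neqNy : forall x, valuation_fun x <> -oo%E;
  valuation_eqy : forall x, valuation_fun x = +oo%E <-> x = 0;
  valuationM : forall x y,
    valuation_fun (x * y) = (valuation_fun x + valuation_fun y)%E;
  valuationD : forall x y,
    (Order.min (valuation_fun x) (valuation_fun y) <= valuation_fun (x + y))%E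
}.

Definition nontrivial_valuation (R : realType) (K : fieldType)
    (val : valuation R K) : Prop :=
  exists2 x : K, x <> 0 & val x <> 0%E.

Record absval (R : realType) (K : fieldType) := Absval {
  absval_fun :> K -> R;
  absval_ge0 : forall x, 0 <= absval_fun x;
  absval_eq0 : forall x, absval_fun x = 0 <-> x = 0;
  absvalM : forall x y, absval_fun (x * y) = absval_fun x * absval_fun y;
  absvalD : forall x y,
    absval_fun (x + y) <= Order.max (absval_fun x) (absval_fun y)
}.

Section AbsvalOfValuation.
Variables (R : realType) (K : fieldType) (val : valuation R K).

(* expeR -oo = 0, hence |0| = 0. *)
Definition abs_of_val_fun (x : K) : R := fine (expeR (- val x)).

Lemma abs_of_val_ge0 x : 0 <= abs_of_val_fun x.
Proof. by rewrite /abs_of_val_fun fine_ge0 // expeR_ge0. Qed.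

Lemma abs_of_val_eq0 x : abs_of_val_fun x = 0 <-> x = 0.
Proof.
rewrite /abs_of_val_fun -(valuation_eqy val).
have := @valuation_neqNy _ _ val x.
by case: (val x) => [r| |] //= _; split=> // /eqP; rewrite expR_eq0.
Qed.

Lemma abs_of_valM x y :
  abs_of_val_fun (x * y) = abs_of_val_fun x * abs_of_val_fun y.
Proof.
rewrite /abs_of_val_fun valuationM.
have := @valuation_neqNy _ _ val x; have := @valuation_neqNy _ _ val y.
case: (val x) => [r| |] //; case: (val y) => [s| |] //= _ _.
- by rewrite opprD expRD.
- by rewrite mulr0.
- by rewrite mul0r.
- by rewrite mul0r.
Qed.

Lemma abs_of_valD x y :
  abs_of_val_fun (x + y) <= Order.max (abs_of_val_fun x) (abs_of_val_fun y).
Proof.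
have mono (s t : \bar R) : s <> -oo%E -> (s <= t)%E ->
    fine (expeR (- t)) <= fine (expeR (- s)).
  case: s => [s| |] //; case: t => [t| |] // _.
  - by rewrite /= lee_fin ler_expR lerN2.
  - by move=> _; exact: expR_ge0.
have := valuationD val x y; rewrite le_max ge_min /abs_of_val_fun.
by case/orP => /mono -> //; rewrite ?orbT //; exact: valuation_neqNy.
Qed.

Definition abs_of_val : absval R K :=
  Absval abs_of_val_ge0 abs_of_val_eq0 abs_of_valM abs_of_valD.

End AbsvalOfValuation.

(* K with the metric |x - y| defined by the absolute value v. *)
Definition valued (R : realType) (K : fieldType) (v : absval R K) : Type := K.

Section ValuedMetric.
Variables (R : realType) (K : fieldType) (v : absval R K).

Lemma absval1 : v 1 = 1.
Proof.
have /eqP := absvalM v 1 1; rewrite mulr1 -{1}[v 1]mulr1 => /eqP.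
have v1 : v 1 != 0 by apply/eqP => /absval_eq0/eqP; rewrite oner_eq0.
by move/(mulfI v1).
Qed.

Lemma absvalN x : v (- x) = v x.
Proof.
have vN1 : v (-1) = 1.
  apply/eqP; rewrite -(@eqrXn2 _ 2) ?absval_ge0 //.
  by rewrite expr2 -absvalM mulrNN mulr1 absval1 expr1n.
by rewrite -mulN1r absvalM vN1 mul1r.
Qed.

Definition absdist (x y : valued v) : R := v ((x : K) - (y : K)).

Lemma absdistxx x : absdist x x = 0.
Proof. by rewrite /absdist subrr; apply/absval_eq0. Qed.

Lemma absdist_positivity x y : absdist x y = 0 -> x = y.
Proof. by move/absval_eq0/eqP; rewrite subr_eq0 => /eqP. Qed.

Lemma absdist_sym x y : absdist x y = absdist y x.
Proof. by rewrite /absdist -absvalN opprB. Qed.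

Lemma absdist_triangle y x z : absdist x z <= absdist x y + absdist y z.
Proof.
rewrite /absdist -(subrKA (y : K)); apply: (le_trans (absvalD v _ _)).
by rewrite ge_max lerDl lerDr !absval_ge0.
Qed.

HB.instance Definition _ := Choice.copy (valued v) K.
HB.instance Definition _ := isPointed.Build (valued v) (0 : K).
HB.instance Definition _ := isMetric.Build R (valued v)
  absdistxx absdist_positivity absdist_sym absdist_triangle.

End ValuedMetric.

(* The axiom of completeType, as a predicate on absolute values. *)
Definition complete_absval (R : realType) (K : fieldType) (v : absval R K)
    : Prop :=
  forall F : set_system (valued v), ProperFilter F -> cauchy F -> cvg F.

Definition is_alg_closure (K L : fieldType) (i : {rmorphism K -> L}) : Prop :=
  GRing.closed_field_axiom L /\ forall x : L, algebraicOver i x.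

Definition extends_absval (R : realType) (K L : fieldType)
    (i : {rmorphism K -> L}) (v : absval R K) (w : absval R L) : Prop :=
  forall x : K, w (i x) = v x.

Definition is_completion (R : realType) (K L : fieldType)
    (i : {rmorphism K -> L}) (v : absval R K) (w : absval R L) : Prop :=
  [/\ extends_absval i v w, dense (range i : set (valued w))
    & complete_absval w].

(* phi embeds K into (Khat, w), the completion of an algebraic closure L of K
   for an extension u of the absolute value v of K. *)
Definition is_completed_alg_closure (R : realType) (K Khat : fieldType)
    (phi : {rmorphism K -> Khat}) (v : absval R K) (w : absval R Khat)
    : Prop :=
  exists (L : fieldType) (u : absval R L)
      (i : {rmorphism K -> L}) (j : {rmorphism L -> Khat}),
    [/\ is_alg_closure i, extends_absval i v u, is_completion j u w
      & forall x : K, phi x = j (i x)].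

Section Discs.
Variables (R : realType) (K Khat : fieldType).
Variables (phi : {rmorphism K -> Khat}) (w : absval R Khat).

Definition disc (a : K) (r : R) : set Khat := [set z | w (phi a - z) <= r].

(* Discs are identified with subsets of Khat; their order is inclusion. *)
Definition discs : set (set Khat) :=
  [set B | exists (a : K) (r : R), 0 <= r /\ B = disc a r].

Definition abs_poly (f : {poly K}) (B : set Khat) : R :=
  sup [set w (map_poly phi f).[z] | z in B].

Definition is_global_min (l : set Khat -> R) (B : set Khat) : Prop :=
  discs B /\ l B = inf [set l B' | B' in discs].

End Discs.

Definition splits (K : fieldType) (f : {poly K}) : Prop :=
  exists rs : seq K, f %= \prod_(x <- rs) ('X - x%:P).

(* Main.v *)
Require Import Defs.
From HB Require Import structures.
From mathcomp Require Import all_boot all_order all_algebra.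
From mathcomp Require Import all_classical all_reals all_analysis.

(* The value of l at a disc with center a is at least its value at the point a,
   so it suffices to minimize the continuous function sum_i a_i |f_i(x)| over K.
   If |z| > R, then the leading term dominates and |f_i(z)| > |f_i(0)| for every
   i, because R |b_(i, n_i)| bounds all coefficients of f_i; hence a minimal disc
   lies in B(0, R), and a minimum exists by compactness of the closed balls of K.
   That |f|(B_Gauss) bounds the coefficients of f follows by interpolation at
   points of the unit disc with pairwise distance 1, which exist since the
   algebraic closure has an infinite residue field.
   If the f_i split, let rho be a root nearest to the center b of a minimal disc.
   Then |f_i(rho)| <= |f_i(b)| for all i, strictly for some i unless b is a root;
   so b is a root of some f_i, and the radius is 0, since f_i does not vanish
   identically on a disc of positive radius. *)

Import Order.TTheory GRing.Theory Num.Theory.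
Import numFieldNormedType.Exports.

Local Open Scope classical_set_scope.
Local Open Scope ring_scope.

(** * Ultrametric estimates for an absolute value *)

Section AbsoluteValue.
Context {R : realType} {K : fieldType} (v : absval R K).

Lemma absval0 : v 0 = 0.
Proof. exact/absval_eq0. Qed.

Lemma absval_gt0 (x : K) : (0 < v x) = (x != 0).
Proof.
rewrite lt_def absval_ge0 andbT; congr (~~ _).
by apply/eqP/eqP => /(absval_eq0 v).
Qed.

Lemma absvalX (x : K) n : v (x ^+ n) = v x ^+ n.
Proof. by elim: n => [|n IHn]; rewrite ?expr0 ?absval1 // !exprS absvalM IHn. Qed.

Lemma absvalV (x : K) : x != 0 -> v x^-1 = (v x)^-1.
Proof.
move=> x0; have vx0 : v x != 0 by rewrite gt_eqF ?absval_gt0.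
by apply: (mulfI vx0); rewrite -absvalM !divff ?absval1.
Qed.

Lemma absval_prod (I : Type) (s : seq I) (F : I -> K) :
  v (\prod_(i <- s) F i) = \prod_(i <- s) v (F i).
Proof. by apply: (big_morph v (absvalM v) (absval1 v)). Qed.

Lemma absvalD_le (x y : K) M : v x <= M -> v y <= M -> v (x + y) <= M.
Proof. by move=> xM yM; rewrite (le_trans (absvalD v x y)) // ge_max xM. Qed.

Lemma absvalB_le (x y : K) M : v x <= M -> v y <= M -> v (x - y) <= M.
Proof. by move=> xM yM; apply: absvalD_le; rewrite ?absvalN. Qed.

Lemma absvalB_lt (x y : K) M : v x < M -> v y < M -> v (x - y) < M.
Proof.
by move=> xM yM; rewrite (le_lt_trans (absvalD v x (- y))) // gt_max absvalN xM.
Qed.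

Lemma absval_sum_lt (I : Type) (s : seq I) (F : I -> K) M :
  0 < M -> (forall i, v (F i) < M) -> v (\sum_(i <- s) F i) < M.
Proof.
move=> M0 FM; elim/big_rec: _ => [|i x _ xM]; first by rewrite absval0.
by rewrite -[x]opprK absvalB_lt ?absvalN.
Qed.

Lemma absval_dist (x y : K) : `|v x - v y| <= v (x - y).
Proof.
have triang s t : v s <= v (s - t) + v t.
  rewrite -{1}(subrK t s) (le_trans (absvalD v _ _)) // ge_max.
  by rewrite lerDl lerDr !absval_ge0.
rewrite ler_norml lerBlDr triang andbT -(absvalN v (x - y)) opprB.
by rewrite lerNl opprB lerBlDr triang.
Qed.

(** * Bounds on balls and continuity of polynomials *)

Lemma absval_horner_bounded (p : {poly K}) (r : R) :
  exists2 M, 0 < M & forall x, v x <= r -> v p.[x] <= M.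
Proof.
elim/poly_ind: p => [|p c [M M0 pM]].
  by exists 1 => // x _; rewrite horner0 absval0.
(* [Num.max 0 r] keeps the bound nonnegative for negative [r]; the summand 1 makes it positive. *)
have M1 : 0 < 1 + v c + M * Num.max 0 r.
  by rewrite !ltr_wpDr ?absval_ge0 // mulr_ge0 ?(ltW M0) // le_max lexx.
exists (1 + v c + M * Num.max 0 r) => // x xr; rewrite hornerMXaddC.
apply: absvalD_le.
  rewrite absvalM ler_wpDl ?addr_ge0 ?absval_ge0 //.
  by rewrite ler_pM ?absval_ge0 ?pM // le_max xr orbT.
rewrite -addrA ler_wpDl // ler_wpDr //.
by rewrite mulr_ge0 ?(ltW M0) // le_max lexx.
Qed.

(** One has p(y) - p(x) = q(y)(y - x), with q bounded by M on the ball of radius 1 + |x|. This ball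
    contains all y within 1 of x, hence the choice [Num.min 1 (e / M)]. *)
Lemma horner_continuous (p : {poly K}) :
  continuous ((fun x => p.[x]) : valued v -> valued v).
Proof.
move=> x U /nbhs_ballP[e /= e0 eU].
have /factor_theorem[q pE] : root (p - p.[x]%:P) x.
  by rewrite rootE !hornerE subrr.
have [M M0 qM] := absval_horner_bounded q (1 + v x).
apply/nbhs_ballP; exists (Num.min 1 (e / M)).
  by rewrite /= lt_min ltr01 divr_gt0.
move=> y xy; apply: eU; move: xy; rewrite !ballEmdist /= lt_min => /andP[/ltW xy1 xye].
have -> : mdist (p.[x] : valued v) (p.[y] : valued v) = v (q.[y] * (x - y)).
  rewrite -absvalN -mulrN opprB.
  have := congr1 (fun g => g.[y]) pE.
  rewrite !hornerE => <-; rewrite -absvalN opprB.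
  by [].
rewrite absvalM; apply: (@le_lt_trans _ _ (M * v (x - y))); last first.
  by rewrite mulrC -ltr_pdivlMr.
rewrite ler_wpM2r ?absval_ge0 // qM //.
rewrite -(subrK x y); apply: absvalD_le; last by rewrite lerDr.
by rewrite -absvalN opprB ler_wpDr ?absval_ge0.
Qed.

Lemma absval_continuous : continuous (fun x : valued v => v x).
Proof.
move=> x; apply/(cvgrPdist_lt _ (FF := nbhs_filter (x : valued v))) => e e0.
apply/nbhs_ballP; exists e => // y.
by rewrite ballEmdist; apply: le_lt_trans; exact: absval_dist.
Qed.

Lemma absval_horner_continuous (p : {poly K}) :
  continuous (fun x : valued v => v p.[x]).
Proof.
move=> x; apply: (@continuous_comp _ _ _
  ((fun x => p.[x]) : valued v -> valued v) (fun y : valued v => v y)).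
  exact: horner_continuous.
exact: absval_continuous.
Qed.

(** * Small elements, compact balls, nonzero values near a point *)

Lemma exists_absval_lt (t : K) (e : R) :
  t != 0 -> v t < 1 -> 0 < e -> exists2 u, u != 0 & v u < e.
Proof.
move=> t0 t1 e0.
have vt1 : `|v t| < 1 by rewrite ger0_norm ?absval_ge0.
have /cvgrPdist_lt/(_ e e0)[n _ /(_ n (leqnn n))] := cvg_expr vt1.
rewrite /= sub0r normrN ger0_norm ?exprn_ge0 ?absval_ge0 // -absvalX => tn.
by exists (t ^+ n) => //; rewrite expf_neq0.
Qed.

(** A compact neighbourhood of 0 contains a ball of some radius e. Dividing by a small nonzero u
    expands it over the whole ball of radius r, which is then a closed subset of a compact image. *)
Lemma compact_absval_le (t : K) (r : R) :
    t != 0 -> v t < 1 -> locally_compact [set: valued v] ->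
  compact [set x : valued v | v x <= r].
Proof.
move=> t0 t1 /(_ 0 I)[U U0 [cU _]].
have /nbhs_ballP[e /= e0 eU] :=
  @filterS _ _ (nbhs_filter (0 : valued v)) _ _ (fun y Uy => Uy I) U0.
have r1 : 0 < `|r| + 1 by rewrite ltr_wpDl.
have [u u0 ue] := exists_absval_lt t _ t0 t1 (divr_gt0 e0 r1).
(* Multiplication by u^-1, written as a polynomial so that [horner_continuous] applies. *)
pose g (x : valued v) : valued v := ((u^-1)%:P * 'X).[x].
have cg : continuous g := @horner_continuous _.
apply: (@subclosed_compact _ _ (g @` U)).
- apply: (@preimage_closed _ _ (fun x : valued v => v x) [set y | y <= r]).
    by move=> x _; exact: absval_continuous.
  exact: closed_le.
- by apply: continuous_compact => //; exact: continuous_subspaceT.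
- move=> x /= xr; exists (u * x : K); last first.
    by rewrite /g hornerM hornerX hornerC mulKf.
  apply: eU; rewrite ballEmdist /= /mdist /=.
  rewrite /absdist sub0r absvalN absvalM.
  apply: le_lt_trans (_ : v u * (`|r| + 1) < e); last by rewrite -ltr_pdivlMr.
  rewrite ler_wpM2l ?absval_ge0 // (le_trans xr) // (le_trans (ler_norm r)) //.
  by rewrite lerDl.
Qed.

(** For |u| < r the points x - u t^k lie within r of x, and they are pairwise distinct because 0 <
    |t| < 1. Among [size p] of them, one is not a root. *)
Lemma exists_horner_neq0_near (p : {poly K}) (t x : K) (r : R) :
    t != 0 -> v t < 1 -> p != 0 -> 0 < r ->
  exists2 y, v (x - y) <= r & p.[y] != 0.
Proof.
move=> t0 t1 p0 r0; have [u u0 ur] := exists_absval_lt t _ t0 t1 r0.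
pose s := mkseq (fun k => x - u * t ^+ k) (size p).
have [sp|] := boolP (all (root p) s).
  suff /(max_poly_roots p0 sp) : uniq s by rewrite size_mkseq ltnn.
  apply: mkseq_uniq => m n /subrI/(mulfI u0)/(congr1 v).
  have vt0 : 0 < v t by rewrite absval_gt0.
  by rewrite !absvalX; exact: (ieexprIn vt0 (negbT (lt_eqF t1))).
case/allPn => y /mapP[k _ ->] yp; exists (x - u * t ^+ k) => //.
rewrite opprB addrC subrK absvalM absvalX ltW // (le_lt_trans _ ur) //.
by rewrite ler_piMr ?absval_ge0 // exprn_ile1 ?absval_ge0 // ltW.
Qed.

(** * Domination by the leading term, and coefficient bounds from values *)

Lemma absval_horner0_lt (p : {poly K}) (r : R) (z : K) :
    (1 < size p)%N -> (forall j, v p`_j <= r * v (lead_coef p)) -> r < v z ->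
  v p.[0] < v p.[z].
Proof.
move=> sp pr rz.
have vl0 : 0 < v (lead_coef p).
  by rewrite absval_gt0 lead_coef_eq0 -size_poly_gt0 ltnW.
(* The hypothesis at the top degree compares the leading coefficient with itself. *)
have r1 : 1 <= r.
  by have := pr (size p).-1; rewrite -lead_coefE ler_pMl.
have z1 : 1 <= v z by exact: le_trans r1 (ltW rz).
have [m sm] : exists m, size p = m.+2 by case: (size p) sp => [|[|m]] // _; exists m.
(* The absolute value of the leading term at z. Since |p_j| < |lead_coef p| |z| and |z| >= 1, every
   lower term is strictly smaller. *)
pose T := v (lead_coef p) * v z ^+ m.+1.
have z0 : 0 < v z by exact: lt_le_trans z1.
have coefT j : v p`_j < v (lead_coef p) * v z.
  by rewrite (le_lt_trans (pr j)) // mulrC ltr_pM2l.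
have T0 : 0 < T by rewrite mulr_gt0 // exprn_gt0.
apply: (@lt_le_trans _ _ T).
  rewrite horner_coef0 (lt_le_trans (coefT _)) // ler_pM2l //.
  by rewrite exprS ler_peMr ?(ltW z0) // exprn_ege1.
(* If |p(z)| < T, the leading term, being p(z) minus the lower terms, would itself be smaller than
   T. *)
rewrite leNgt; apply/negP => pz.
suff : v (p.[z] - \sum_(j < m.+1) p`_j * z ^+ j) < T.
  have -> : p.[z] = \sum_(j < m.+1) p`_j * z ^+ j + lead_coef p * z ^+ m.+1.
    by rewrite horner_coef sm big_ord_recr lead_coefE sm.
  by rewrite addrC addKr absvalM absvalX ltxx.
apply: absvalB_lt => //; apply: absval_sum_lt => // j.
rewrite absvalM absvalX /T exprS mulrA.
apply: (@lt_le_trans _ _ (v (lead_coef p) * v z * v z ^+ j)).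
  by rewrite ltr_pM2r ?exprn_gt0.
by rewrite ler_pM2l ?mulr_gt0 // ler_weXn2l // -ltnS.
Qed.

(* Newton interpolation: dividing by X - x loses nothing, as |y - x| = 1 at the
   remaining nodes y. *)
Lemma absval_coef_le (s : seq K) (p : {poly K}) (M : R) :
    0 <= M -> (size p <= size s)%N -> (forall x, x \in s -> v x <= 1) ->
    pairwise (fun x y => v (x - y) == 1) s ->
    (forall x, x \in s -> v p.[x] <= M) ->
  forall j, v p`_j <= M.
Proof.
move=> M0; elim: s p => [|x s IHs] p.
  by rewrite leqn0 size_poly_eq0 => /eqP -> _ _ _ j; rewrite coef0 absval0.
move=> sp s1; rewrite pairwise_cons => /andP[/allP xs ss] pM.
have /factor_theorem[q pE] : root (p - p.[x]%:P) x.
  by rewrite rootE !hornerE subrr.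
have px : v p.[x] <= M by apply: pM; rewrite mem_head.
have sq : (size q <= size s)%N.
  have [->|q0] := eqVneq q 0; first by rewrite size_poly0.
  have := congr1 (fun g : {poly K} => size g) pE.
  rewrite size_mul ?polyXsubC_eq0 // size_XsubC addn2 /= -ltnS => <-.
  rewrite (leq_trans (size_polyD _ _)) // geq_max sp size_polyN.
  exact: leq_trans (size_polyC_leq1 _) _.
have qM : forall j, v q`_j <= M.
  apply: IHs => // [y ys|y ys]; first by apply: s1; rewrite inE ys orbT.
  have yM : v (p.[y] - p.[x]) <= M.
    by apply: absvalB_le => //; apply: pM; rewrite inE ys orbT.
  have := congr1 (fun g => v g.[y]) pE.
  rewrite !hornerE absvalM -[v (y - x)]absvalN opprB (eqP (xs y ys)) mulr1.
  by move=> <-.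
(* Coefficientwise p = q X - x q + p(x), and |x| <= 1, so the bound on q passes to p. *)
move=> j; rewrite -(subrK p.[x]%:P p) pE mulrBr coefD coefB coefMX coefMC coefC.
have x1 : v x <= 1 by apply: s1; rewrite mem_head.
apply: absvalD_le; last by case: eqP => _; rewrite ?absval0.
apply: absvalB_le; first by case: eqP => _; rewrite ?absval0.
rewrite absvalM; apply: le_trans (qM j).
by rewrite ler_piMr ?absval_ge0.
Qed.

(** The axiom solves x^n = P_0 + ... + P_(n-1) x^(n-1); take for P_i the negated coefficients of
    p. *)
Lemma closed_field_monic_root (p : {poly K}) :
  GRing.closed_field_axiom K -> p \is monic -> (1 < size p)%N ->
  exists x, root p x.
Proof.
move=> clK /monicP; rewrite lead_coefE.
case sp : (size p) => [|[|n]] //= pn _.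
have [x xn] := clK n.+1 (fun i => - p`_i) isT.
exists x; rewrite rootE horner_coef sp big_ord_recr /= pn mul1r xn -big_split.
by rewrite big1 //= => i _; rewrite mulNr subrr.
Qed.

(* A root of X (X - x_1) ... (X - x_n) + 1 is at distance 1 from 0 and from
   every x_i. *)
Lemma exists_separated_points (n : nat) :
  GRing.closed_field_axiom K ->
  exists s : seq K, [/\ size s = n, forall x, x \in s -> v x <= 1
    & pairwise (fun x y => v (x - y) == 1) s].
Proof.
move=> clK; elim: n => [|n [s [sn s1 ss]]]; first by exists [::].
(* The factor at 0 makes the degree positive even when [s] is empty. *)
pose P := \prod_(x <- 0 :: s) ('X - x%:P).
have sP : size P = n.+2 by rewrite size_prod_XsubC /= sn.
have sP1 : size (P + 1) = n.+2 by rewrite size_polyDl sP // size_poly1.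
have mP1 : P + 1 \is monic.
  rewrite monicE lead_coefDl ?sP ?size_poly1 //.
  by have /monicP -> : P \is monic by exact: monic_prod_XsubC.
have [|z] := closed_field_monic_root _ clK mP1; first by rewrite sP1.
rewrite rootE hornerD hornerC addr_eq0 => /eqP/(congr1 v).
rewrite absvalN absval1 horner_prod absval_prod => prod1.
have s01 x : x \in 0 :: s -> v x <= 1.
  by rewrite inE => /predU1P[->|/s1 //]; rewrite absval0.
have dist_ge (x : K) : 1 < v z -> x \in 0 :: s -> 1 < v ('X - x%:P).[z].
  move=> z1 /s01 x1; rewrite hornerXsubC ltNge; apply/negP => zx.
  by have := absvalD_le _ _ _ zx x1; rewrite subrK leNgt z1.
(* If |z| > 1, every factor |z - x| exceeds 1, whereas their product is 1. *)
have z1 : v z <= 1.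
  rewrite leNgt; apply/negP => z1.
  have := prod1; apply/eqP; rewrite gt_eqF // big_cons.
  rewrite (lt_le_trans (dist_ge _ z1 (mem_head _ _))) //.
  rewrite ler_peMr ?absval_ge0 // big_seq.
  elim/big_ind: _ => // [x y x1 y1|x xs]; first exact: mulr_ege1.
  by rewrite ltW // dist_ge // inE xs orbT.
exists (z :: s); split => /=; first by rewrite sn.
- by move=> x; rewrite inE => /predU1P[->|/s1].
rewrite ss andbT; apply/allP => x xs.
have dist_le y : y \in 0 :: s -> v ('X - y%:P).[z] <= 1.
  by move=> /s01 y1; rewrite hornerXsubC absvalB_le.
(* All factors are at most 1, so the one at x is at least the whole product, which is 1. *)
rewrite eq_le -{1}hornerXsubC dist_le ?inE ?xs ?orbT //= -prod1.
rewrite (big_rem x) ?inE ?xs ?orbT // hornerXsubC.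
rewrite ler_piMr ?absval_ge0 // big_seq prodr_ile1 // => y ys.
by rewrite absval_ge0 dist_le //; exact: mem_rem ys.
Qed.

End AbsoluteValue.

(** * Nontrivial valuations, finite minima and sums, split polynomials *)

Lemma exists_abs_of_val_lt1 {R : realType} {K : fieldType}
    (val : valuation R K) : nontrivial_valuation val ->
  exists2 t : K, t != 0 & abs_of_val val t < 1.
Proof.
move=> [x /eqP x0 valx]; have [x1|x1|x1] := ltgtP (abs_of_val val x) 1.
- by exists x.
- exists x^-1; rewrite ?invr_eq0 // absvalV //.
  by rewrite invf_lt1 // (lt_trans ltr01).
- case: valx; have := @valuation_neqNy _ _ val x; have := valuation_eqy val x.
  move: x1; rewrite /= /abs_of_val_fun; case: (val x) => [r| |] //=.
    by rewrite -expR0 => /expR_inj/eqP; rewrite oppr_eq0 => /eqP ->.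
  by move=> _ [/(_ erefl)/eqP]; rewrite (negbTE x0).
Qed.

Lemma exists_min_seq {R : realType} {T : eqType} (F : T -> R) (s : seq T) :
  s != [::] -> exists2 x, x \in s & forall y, y \in s -> F x <= F y.
Proof.
elim: s => // x s IHs _; have [->|/IHs[m ms mF]] := eqVneq s [::].
  by exists x; rewrite ?mem_head // => y; rewrite inE => /eqP ->.
have [xm|mx] := leP (F x) (F m).
  exists x; rewrite ?mem_head // => y; rewrite inE => /predU1P[-> //|/mF].
  exact: le_trans.
by exists m => [|y]; rewrite inE ?ms ?orbT // => /predU1P[->|/mF //]; exact: ltW.
Qed.

Lemma ltr_sum_pos {R : realType} {I : finType} (c F G : I -> R) (i : I) :
    (forall j, 0 < c j) -> (forall j, F j <= G j) -> F i < G i ->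
  \sum_j c j * F j < \sum_j c j * G j.
Proof.
move=> c0 FG FGi; rewrite (bigD1 i) // [ltRHS](bigD1 i) //=.
rewrite ltr_leD ?ltr_pM2l // ler_sum // => j _.
by rewrite ler_pM2l.
Qed.

(** [splits] only gives equality up to a nonzero constant; as the product is monic, that constant is
    the leading coefficient. *)
Lemma splits_roots {K : fieldType} (p : {poly K}) : splits p -> p != 0 ->
  exists rs : seq K, p = lead_coef p *: \prod_(x <- rs) ('X - x%:P).
Proof.
move=> [rs /eqpP[[c d] /= /andP[c0 d0] cd]] p0; exists rs.
have pE : p = (d / c) *: \prod_(x <- rs) ('X - x%:P).
  by rewrite mulrC -scalerA -cd scalerK.
have /monicP lead1 : \prod_(x <- rs) ('X - x%:P) \is monic.
  exact: monic_prod_XsubC.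
by rewrite {2}pE lead_coefZ lead1 mulr1.
Qed.

(** * Absolute polynomials on discs *)

Section Discs.
Context {R : realType} {K Khat : fieldType} {phi : {rmorphism K -> Khat}}.
Context {v : absval R K} {w : absval R Khat}.
Hypothesis wphi : forall x, w (phi x) = v x.

Lemma disc_center (a : K) (r : R) : 0 <= r -> disc phi w a r (phi a).
Proof. by rewrite /disc /= subrr absval0. Qed.

Lemma disc_image (a x : K) (r : R) : v (a - x) <= r -> disc phi w a r (phi x).
Proof. by rewrite /disc /= -rmorphB wphi. Qed.

Lemma disc0E (a : K) : disc phi w a 0 = [set phi a].
Proof.
apply/seteqP; split => z /=; rewrite /disc /=; last first.
  by move=> ->; rewrite subrr absval0.
move=> az; have /absval_eq0/eqP : w (phi a - z) = 0.
  by apply/le_anti; rewrite az absval_ge0.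
by rewrite subr_eq0 => /eqP ->.
Qed.

(** [sup] bounds the members of a set only if the set is bounded above. Here it is, as a disc lies
    in a ball around 0, on which f is bounded. *)
Lemma abs_poly_ge (f : {poly K}) (B : set Khat) (z : Khat) :
  discs phi w B -> B z -> w (map_poly phi f).[z] <= abs_poly phi w f B.
Proof.
move=> [a [r [r0 ->]]] Bz; apply: ub_le_sup; last by exists z.
have [M _ fM] :=
  absval_horner_bounded w (map_poly phi f) (Num.max (w (phi a)) r).
exists M => _ /= [x ax <-]; apply: fM.
by rewrite -[x](subKr (phi a)) absvalB_le // le_max ?lexx // ax orbT.
Qed.

Lemma abs_poly_ge_image (f : {poly K}) (B : set Khat) (x : K) :
  discs phi w B -> B (phi x) -> v f.[x] <= abs_poly phi w f B.
Proof. by move=> dB /(abs_poly_ge f _ _ dB); rewrite horner_map wphi. Qed.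

Lemma abs_poly_point (f : {poly K}) (x : K) :
  abs_poly phi w f (disc phi w x 0) = v f.[x].
Proof. by rewrite /abs_poly disc0E image_set1 sup1 horner_map /= wphi. Qed.

Lemma discs_point (x : K) : discs phi w (disc phi w x 0).
Proof. by exists x, 0. Qed.

Lemma abs_poly_ge0 (f : {poly K}) (B : set Khat) :
  discs phi w B -> 0 <= abs_poly phi w f B.
Proof.
move=> dB; have [a [r [r0 BE]]] := dB.
apply: le_trans (absval_ge0 _ _) (abs_poly_ge f _ (phi a) dB _).
by rewrite BE; exact: disc_center.
Qed.

(** The interpolation nodes are found in the algebraically closed [L] and carried by [j] into the
    unit disc of [Khat]; [size f] of them control all coefficients. *)
Lemma coef_le_abs_poly_Gauss (L : fieldType) (u : absval R L)
    (j : {rmorphism L -> Khat}) (f : {poly K}) (k : nat) :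
    GRing.closed_field_axiom L -> (forall x, w (j x) = u x) ->
  v f`_k <= abs_poly phi w f (disc phi w 0 1).
Proof.
move=> clL wj; have dG : discs phi w (disc phi w 0 1) by exists 0, 1.
have [s [sn s1 ss]] := exists_separated_points u (size f) clL.
rewrite -wphi -coef_map.
apply: (absval_coef_le w [seq j x | x <- s]).
- exact: abs_poly_ge0.
- by rewrite size_map sn size_map_poly.
- by move=> _ /mapP[x xs ->]; rewrite wj s1.
- rewrite pairwise_map; apply: sub_pairwise ss => x y /=.
  by rewrite -rmorphB wj.
- move=> _ /mapP[x xs ->]; apply: abs_poly_ge => //.
  by rewrite /disc /= rmorph0 sub0r absvalN wj s1.
Qed.

(** * Global minima of positive combinations *)

Section GlobalMin.
Context {N : nat} {a : 'I_N -> R} {f : 'I_N -> {poly K}}.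
Hypothesis a_gt0 : forall i, 0 < a i.
Let l (B : set Khat) := \sum_(i < N) a i * abs_poly phi w (f i) B.

(** The values of [l] are bounded below by 0, so [inf] is a genuine infimum. *)
Lemma is_global_minP (B : set Khat) :
  is_global_min phi w l B <->
  discs phi w B /\ forall B', discs phi w B' -> l B <= l B'.
Proof.
have lbl : has_lbound [set l B' | B' in discs phi w].
  exists 0 => _ [B' dB' <-]; apply: sumr_ge0 => i _.
  by rewrite mulr_ge0 ?(ltW (a_gt0 i)) ?abs_poly_ge0.
split=> -[dB lB]; split => //.
  by move=> B' dB'; rewrite lB ge_inf //; exists B'.
apply/le_anti/andP; split; last by rewrite ge_inf //; exists B.
apply: lb_le_inf; first by exists (l B), B.
by move=> _ [B' dB' <-]; exact: lB.
Qed.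

Lemma is_global_min_point (x : K) :
    (forall y : K,
      \sum_(i < N) a i * v (f i).[x] <= \sum_(i < N) a i * v (f i).[y]) ->
  is_global_min phi w l (disc phi w x 0).
Proof.
move=> xmin; apply/is_global_minP; split; first exact: discs_point.
move=> B dB; have [b [r [r0 BE]]] := dB.
rewrite /l; under eq_bigr do rewrite abs_poly_point.
apply: le_trans (xmin b) _; apply: ler_sum => i _.
rewrite ler_pM2l // abs_poly_ge_image // BE.
exact: disc_center.
Qed.

(** The competitor is the disc of radius 0 at [x], which need not lie in [B]. It is applied with x =
    0, a nearest root and the centre of [B]. *)
Lemma not_global_min (B : set Khat) (x : K) (i : 'I_N) :
    discs phi w B ->
    (forall j, v (f j).[x] <= abs_poly phi w (f j) B) ->
    v (f i).[x] < abs_poly phi w (f i) B ->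
  ~ is_global_min phi w l B.
Proof.
move=> dB xB xBi /is_global_minP[_ /(_ _ (discs_point x))].
apply/negP; rewrite -ltNge; apply: (ltr_sum_pos _ _ _ i) => // [j|];
  by rewrite abs_poly_point.
Qed.

Lemma global_min_sub_disc (r : R) (B : set Khat) : (0 < N)%N ->
    (forall i z, r < w z -> v (f i).[0] < w (map_poly phi (f i)).[z]) ->
  is_global_min phi w l B -> B `<=` disc phi w 0 r.
Proof.
move=> N0 fr mB z Bz; rewrite /disc /= rmorph0 sub0r absvalN leNgt.
apply/negP => rz; have /is_global_minP[dB _] := mB.
have lt0 i : v (f i).[0] < abs_poly phi w (f i) B.
  exact: lt_le_trans (fr i z rz) (abs_poly_ge _ _ _ dB Bz).
(* [0 < N] supplies an index at which the point 0 is strictly better. *)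
exact: (not_global_min B 0 (Ordinal N0) dB (fun i => ltW (lt0 i))) mB.
Qed.

Lemma global_min_root (t : K) (B : set Khat) :
    t != 0 -> v t < 1 -> (0 < N)%N -> (forall i, (1 < size (f i))%N) ->
    (forall i, splits (f i)) -> is_global_min phi w l B ->
  exists (i : 'I_N) (x : K), root (f i) x /\ B = disc phi w x 0.
Proof.
move=> t0 t1 N0 sf spf mB; have /is_global_minP[dB _] := mB.
have f0 i : f i != 0 by rewrite -size_poly_gt0 ltnW.
have /choice[rs fE] : forall i, exists rs : seq K,
    f i = lead_coef (f i) *: \prod_(x <- rs) ('X - x%:P).
  by move=> i; exact: splits_roots.
have rootE i x : root (f i) x = (x \in rs i).
  by rewrite fE rootZ ?lead_coef_eq0 // root_prod_XsubC.
have [b [r [r0 BE]]] := dB.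
have Bb : B (phi b) by rewrite BE; exact: disc_center.
pose allroots := flatten [seq rs i | i : 'I_N].
have mem_allroots i x : root (f i) x -> x \in allroots.
  rewrite rootE => xi; apply/flattenP; exists (rs i) => //.
  by apply: map_f; rewrite mem_enum.
(* The list is nonempty: there is some [f i], and it has positive degree. *)
have [|rho rho_root rho_min] := exists_min_seq (fun x => v (b - x)) allroots.
  have : rs (Ordinal N0) != [::].
    apply/eqP => rs0; have := sf (Ordinal N0).
    by rewrite fE rs0 big_nil size_scale ?size_poly1 ?lead_coef_eq0.
  case E : (rs (Ordinal N0)) => [//|x s] _; apply/eqP => all0.
  have := mem_allroots (Ordinal N0) x.
  by rewrite rootE E mem_head all0 => /(_ isT).
have [i rho_i] : exists i, root (f i) rho.
  have /flattenP[_ /mapP[i _ ->]] := rho_root.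
  by rewrite -rootE => ?; exists i.
(* By the ultrametric inequality, |rho - x| <= |b - x| for each root x. *)
have rho_le j : v (f j).[rho] <= v (f j).[b].
  rewrite fE !hornerZ !absvalM ler_wpM2l ?absval_ge0 //.
  rewrite !horner_prod !absval_prod big_seq [leRHS]big_seq.
  apply: ler_prod => x; rewrite -rootE => /mem_allroots/rho_min bx.
  rewrite absval_ge0 !hornerXsubC /= -(subrKA b) absvalD_le //.
  by rewrite -absvalN opprB.
(* Otherwise the point rho is at least as good as [B] for every j and strictly better for [i]. *)
have froot : root (f i) b.
  apply: contrapT => /negP bi.
  apply: (not_global_min B rho i dB _ _ mB) => [j|].
    exact: le_trans (rho_le j) (abs_poly_ge_image _ _ _ dB Bb).
  apply: lt_le_trans (abs_poly_ge_image _ _ _ dB Bb).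
  by rewrite (rootP rho_i) absval0 absval_gt0.
exists i, b; split=> //; rewrite BE; congr disc.
move: r0; rewrite le_eqVlt => /predU1P[//|rgt0].
(* If r > 0, [f i] is nonzero at some y of K in the disc, so shrinking the disc to b, where [f i]
   vanishes, lowers [l]. *)
have [y by_ fy] := exists_horner_neq0_near v (f i) t b r t0 t1 (f0 i) rgt0.
exfalso; apply: (not_global_min B b i dB _ _ mB) => [j|].
  exact: abs_poly_ge_image.
rewrite (rootP froot) absval0.
apply: lt_le_trans (_ : v (f i).[y] <= _); first by rewrite absval_gt0.
by apply: abs_poly_ge_image => //; rewrite BE; exact: disc_image.
Qed.

End GlobalMin.
End Discs.

(** * Existence and location of minima over a locally compact field *)

Theorem theorem62 (R : realType) (K : fieldType) (val : valuation R K)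
    (Khat : fieldType) (phi : {rmorphism K -> Khat}) (w : absval R Khat)
    (N : nat) (a : 'I_N -> R) (f : 'I_N -> {poly K}) :
  nontrivial_valuation val ->
  complete_absval (abs_of_val val) ->
  is_completed_alg_closure phi (abs_of_val val) w ->
  locally_compact [set: valued (abs_of_val val)] ->
  (0 < N)%N ->
  (forall i, 0 < a i) ->
  (forall i, (1 < size (f i))%N) ->
  let l := fun B : set Khat => \sum_(i < N) a i * abs_poly phi w (f i) B in
  let Gauss := disc phi w 0 1 in
  let radius := \big[Order.max/0]_(i < N)
    (abs_poly phi w (f i) Gauss / abs_of_val val (lead_coef (f i))) in
  [/\ exists B, is_global_min phi w l B,
      forall B, is_global_min phi w l B -> B `<=` disc phi w 0 radius
    & (forall i, splits (f i)) ->
      forall B, is_global_min phi w l B ->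
        exists (i : 'I_N) (x : K), root (f i) x /\ B = disc phi w x 0].
Proof.
move=> nt _ [L [u [i [j [[clL _] uv [wj _ _] phiE]]]]] lc N0 a0 sf l Gauss radius.
set v := abs_of_val val in lc uv radius *.
have wphi x : w (phi x) = v x by rewrite phiE wj uv.
have [t t0 t1] := exists_abs_of_val_lt1 _ nt.
have far k z : radius < w z -> v (f k).[0] < w (map_poly phi (f k)).[z].
  move=> rz; rewrite -wphi -horner_map rmorph0.
  apply: absval_horner0_lt rz; first by rewrite size_map_poly.
  (* Each coefficient is bounded by the value at the Gauss disc, hence by [radius] times the leading
     coefficient. *)
  move=> m; rewrite coef_map lead_coef_map !wphi.
  have vl0 : 0 < v (lead_coef (f k)).
    by rewrite absval_gt0 lead_coef_eq0 -size_poly_gt0 ltnW.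
  rewrite -ler_pdivrMr //; apply: le_trans (le_bigmax _ _ k).
  rewrite ler_pM2r ?invr_gt0 //.
  exact: coef_le_abs_poly_Gauss clL wj.
split.
(* F is [l] on discs of radius 0; it is minimized over a compact ball. *)
- pose F (x : valued v) := \sum_(k < N) a k * v (f k).[x].
  have Fcont : continuous F.
    apply: continuous_big => [|k _ x]; first exact: add_continuous.
    apply: (@cvgM _ _ _ (nbhs_filter x)); first exact: cvg_cst.
    exact: absval_horner_continuous.
  (* The maximum with 0 places the origin in the ball. *)
  pose r := Num.max 0 radius.
  have v0r : v 0 <= r by rewrite absval0 le_max lexx.
  have [||x _ xmin] := @compact_EVT_min _ R F [set x : valued v | v x <= r] _
    (compact_absval_le v t r t0 t1 lc).
  + by exists (0 : K).
  + exact: continuous_subspaceT.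
  exists (disc phi w x 0); apply: is_global_min_point => // y.
  have [yr|yr] := leP (v y) r; first by apply: xmin; rewrite inE.
  (* For y outside the ball, [far] at [phi y] gives F(0) <= F(y), and 0 is in the ball. *)
  apply: le_trans (_ : F (0 : K) <= _).
    by apply: xmin; rewrite inE.
  apply: ler_sum => k _; rewrite ler_pM2l // ltW //.
  rewrite -[ltRHS]wphi -horner_map far // wphi.
  by rewrite (le_lt_trans _ yr) // le_max lexx orbT.
- by move=> B; exact: global_min_sub_disc.
- by move=> spf B; exact: (global_min_root wphi a0 t).
Qed.
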